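(* For all integers $m,n\geq 3$, the edge corona $C_m\diamond C_n$ of the cycles $C_m$ and $C_n$ is antimagic.
   Context: All graphs are simple, finite and undirected. For a graph $G$ with $q$ edges, an antimagic labeling is a bijection $f:E(G)\to\{1,2,\dots,q\}$ such that the vertex sums $w(u)=\sum_{e\ni u} f(e)$ (sum over the edges incident to $u$) are pairwise distinct over all vertices $u\in V(G)$. A graph is antimagic if it admits an antimagic labeling. $C_m$ denotes the cycle on $m$ vertices. For graphs $G$ and $H$, the edge corona $G\diamond H$ is obtained by taking one copy of $G$ and $|E(G)|$ vertex-disjoint copies of $H$, one copy associated to each edge of $G$, and joining both end vertices of the $i$-th edge of $G$ to every vertex of the $i$-th copy of $H$. *)

(* Defs.v *)
From mathcomp Require Import all_boot.

Set Implicit Arguments.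
Unset Strict Implicit.
Unset Printing Implicit Defensive.

Record sgraph := SGraph {
  svertex :> finType;
  adj : rel svertex;
  adj_sym : symmetric adj;
  adj_irrefl : irreflexive adj }.

Definition edges (G : sgraph) : {set {set G}} :=
  [set [set p.1; p.2] | p : G * G & adj p.1 p.2].

Definition edge (G : sgraph) := {e : {set G} | e \in edges G}.

Section Labeling.
Variable G : sgraph.
(* Only the values of f on edges G matter. *)
Variable f : {set G} -> nat.

Definition edge_labeling : Prop :=
  {in edges G &, injective f} /\
  (forall k, (k \in [seq f e | e in edges G]) = (1 <= k <= #|edges G|)).

Definition vertex_sum (u : G) : nat := \sum_(e in edges G | u \in e) f e.

Definition antimagic_labeling : Prop := edge_labeling /\ injective vertex_sum.
End Labeling.

Definition antimagic (G : sgraph) : Prop :=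
  exists f : {set G} -> nat, antimagic_labeling f.

(* ordS is the successor modulo m; the clause i != j only matters for m = 1. *)
Definition cycle_adj m : rel 'I_m :=
  fun i j => (i != j) && ((j == ordS i) || (i == ordS j)).

Lemma cycle_adj_sym m : symmetric (@cycle_adj m).
Proof. by move=> i j; rewrite /cycle_adj eq_sym orbC. Qed.

Lemma cycle_adj_irrefl m : irreflexive (@cycle_adj m).
Proof. by move=> i; rewrite /cycle_adj eqxx. Qed.

(* This is the graph C_m for m >= 3; for smaller m it is only a path. *)
Definition cycle_graph m : sgraph :=
  SGraph (@cycle_adj_sym m) (@cycle_adj_irrefl m).

Section EdgeCorona.
Variables G H : sgraph.

(* inr (e, h) is the vertex h in the copy of H associated to the edge e. *)
Definition corona_vertex : finType := (G + edge G * H)%type.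

Definition corona_adj : rel corona_vertex := fun x y =>
  match x, y with
  | inl u, inl v => adj u v
  | inl u, inr (e, _) => u \in val e
  | inr (e, _), inl u => u \in val e
  | inr (e, h), inr (e', h') => (e == e') && adj h h'
  end.

Lemma corona_adj_sym : symmetric corona_adj.
Proof.
case=> [u|[e h]] [v|[e' h']] //=; first exact: adj_sym.
by rewrite eq_sym adj_sym.
Qed.

Lemma corona_adj_irrefl : irreflexive corona_adj.
Proof. by case=> [u|[e h]] /=; rewrite adj_irrefl ?andbF. Qed.

Definition edge_corona : sgraph := SGraph corona_adj_sym corona_adj_irrefl.
End EdgeCorona.

(* Main.v *)
(** Write [u_0, ..., u_(m-1)] for the vertices of [C_m] and [(i, j)] for the
    [j]-th vertex of the copy of [C_n] on the edge [u_i u_(i+1)].  The labels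
    are split into three consecutive ranges: the edges of the copies get
    [1, ..., mn], the edges joining the copies to [C_m] get
    [mn + 1, ..., 3mn], and the edges of [C_m] get the rest.  Within the copy
    [i] the cycle labels increase with [j] while the pairs of joining labels
    decrease with [j]: the pair has the larger slope, so the sums strictly
    decrease with [j], except at [j = 0], where they are largest.  The sums at
    [u_i] increase with [i >= 1], in steps of [2L] with [L = 2 n^2 + 1]; the
    sum at [u_0], where the cycle closes up, would differ from the others by a
    multiple of [L], possibly by zero, and exchanging the labels in the pairs
    of the last copy breaks this tie.  Finally the sums at the [u_i] exceed all
    those in the copies. *)

Require Import Defs.
From mathcomp Require Import all_boot.
From mathcomp Require Import zify.

Set Implicit Arguments.
Unset Strict Implicit.
Unset Printing Implicit Defensive.

(** * Labelings given on a type that enumerates the edges *)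

Lemma set2_inj (T : finType) (a b c d : T) :
  [set a; b] = [set c; d] -> (a = c /\ b = d) \/ (a = d /\ b = c).
Proof.
move=> E; have : a \in [set c; d] by rewrite -E set21.
have : b \in [set c; d] by rewrite -E set22.
have : c \in [set a; b] by rewrite E set21.
have : d \in [set a; b] by rewrite E set22.
by do 4 ![case/set2P => ?]; subst; by [left|right].
Qed.

(** Lets labels and sums be defined by cases on an index type instead of on sets of vertices.
    Surjectivity comes for free: [#|E|] distinct labels within an interval of that size fill it. *)
Lemma antimagic_param (G : sgraph) (E : finType) (ends : E -> {set G})
    (lab : E -> nat) :
  injective ends -> edges G = [set ends x | x : E] ->
  injective lab -> (forall x, 1 <= lab x <= #|E|) ->
  injective (fun u => \sum_(x | u \in ends x) lab x) ->
  antimagic G.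
Proof.
move=> ends_inj edgesE lab_inj lab_bnd sum_inj.
pose f e := if [pick x | ends x == e] is Some x then lab x else 0.
have fE x : f (ends x) = lab x.
  rewrite /f; case: pickP => [y /eqP /ends_inj -> //|/(_ x)].
  by rewrite eqxx.
have card_edges : #|edges G| = #|E| by rewrite edgesE card_imset.
have fsum u : vertex_sum f u = \sum_(x | u \in ends x) lab x.
  rewrite /vertex_sum edgesE big_mkcondr big_imset /=; last exact: in2W.
  by rewrite [RHS]big_mkcond; apply: eq_bigr => x _; rewrite fE.
exists f; split; last by move=> u v; rewrite !fsum => /sum_inj.
split.
  by rewrite edgesE => _ _ /imsetP[x _ ->] /imsetP[y _ ->]; rewrite !fE => /lab_inj ->.
move=> k; rewrite card_edges.
have lab_uniq : uniq (codom lab) by apply/injectiveP.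
have sub_iota : {subset codom lab <= iota 1 #|E|}.
  by move=> _ /codomP[x ->]; rewrite mem_iota add1n ltnS.
have [_ codomE] : size (codom lab) = #|E| /\ codom lab =i iota 1 #|E|.
  have [] := uniq_min_size lab_uniq sub_iota; first by rewrite size_iota size_codom.
  by move=> _ ?; rewrite size_codom.
have -> : (1 <= k <= #|E|) = (k \in codom lab).
  by rewrite codomE mem_iota add1n ltnS.
apply/imageP/codomP => [[e]|[x ->]].
  by rewrite edgesE => /imsetP[x _ ->] ->; exists x; rewrite fE.
by exists (ends x); rewrite ?fE // edgesE imset_f.
Qed.

(** * Successor and predecessor on the cycle *)

Lemma val_ordS m (i : 'I_m) : ordS i = (if i.+1 == m then 0 else i.+1) :> nat.
Proof.
rewrite /=; case: eqP => [->|]; first by rewrite modnn.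
by move=> ?; rewrite modn_small //; have := ltn_ord i; lia.
Qed.

Lemma val_ord_pred m (i : 'I_m) :
  ord_pred i = (if i == 0 :> nat then m.-1 else i.-1) :> nat.
Proof.
have := congr1 (@nat_of_ord m) (ord_predK i); have := ltn_ord (ord_pred i).
by rewrite val_ordS; move: (nat_of_ord (ord_pred i)) => p; case: eqP; case: eqP; lia.
Qed.

Lemma ordS_neq m (i : 'I_m) : 1 < m -> i != ordS i.
Proof.
move=> m_gt1; apply/eqP => /(congr1 (@nat_of_ord m)).
by rewrite val_ordS; case: eqP; lia.
Qed.

Lemma cycle_adjE m (i j : 'I_m) : 1 < m ->
  cycle_adj i j = (j == ordS i) || (i == ordS j).
Proof.
move=> m_gt1; rewrite /cycle_adj; case: eqP => // ->.
by rewrite orbb (negPf (ordS_neq _ m_gt1)).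
Qed.

(** Equality with the ends swapped would give [i = i + 2] modulo [m], which [2 < m] excludes. *)
Lemma ordS2_inj m (i j : 'I_m) : 2 < m ->
  [set i; ordS i] = [set j; ordS j] -> i = j.
Proof.
move=> m_gt2 /set2_inj[[] //|[ij ji]]; apply: val_inj.
move: (congr1 (@nat_of_ord m) ij) (congr1 (@nat_of_ord m) ji) (ltn_ord i) (ltn_ord j).
by rewrite !val_ordS /=; do 2 case: eqP; lia.
Qed.

Lemma sum_ordS2 m (u : 'I_m) (F : 'I_m -> nat) : 1 < m ->
  \sum_(i | u \in [set i; ordS i]) F i = F u + F (ord_pred u).
Proof.
move=> m_gt1; rewrite (bigD1 u) ?inE ?eqxx //= (big_pred1 (ord_pred u)) // => i.
rewrite /= !inE [i == ord_pred u]eq_sym (can2_eq (@ord_predK m) (@ordSK m)).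
case: (i =P u) => [->|/eqP i_u]; first by rewrite andbF (negPf (ordS_neq _ m_gt1)).
by rewrite andbT eq_sym (negPf i_u).
Qed.

Lemma radix_inj n a b c d : b < n -> d < n -> n * a + b = n * c + d ->
  a = c /\ b = d.
Proof.
move=> lt_bn lt_dn eq_abcd.
have ac : a = c by case: (ltngtP a c) => // ?; nia.
by split=> //; lia.
Qed.

(** * The edges of the corona and their labels *)

Section CycleCorona.

Variables (m n : nat) (hm : 2 < m) (hn : 2 < n).

Local Notation Cm := (cycle_graph m).
Local Notation Cn := (cycle_graph n).

Lemma cycle_edgesE k : 2 < k ->
  edges (cycle_graph k) = [set [set i; ordS i] | i : 'I_k].
Proof.
move=> k_gt2; apply/setP=> e; apply/imsetP/imsetP => [[[i j] /= + ->]|[i _ ->]].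
  rewrite inE /= cycle_adjE 1?ltnW // => /orP[]/eqP->; first by exists i.
  by exists j; rewrite // setUC.
by exists (i, ordS i); rewrite // inE /= cycle_adjE ?eqxx // ltnW.
Qed.

Lemma cycle_edge_subproof (i : 'I_m) : [set i; ordS i] \in edges Cm.
Proof. by rewrite cycle_edgesE //; apply/imsetP; exists i. Qed.

Definition cycle_edge (i : 'I_m) : edge Cm :=
  exist _ [set i; ordS i] (cycle_edge_subproof i).

Lemma cycle_edgeP (e : edge Cm) : exists i, e = cycle_edge i.
Proof.
case: e => e eP; have := eP; rewrite {1}cycle_edgesE // => /imsetP[i _ eE].
by exists i; apply: val_inj.
Qed.

(* The edges of C_m, those of the copies of C_n, and the joining edges; the
   boolean tells which end of the edge of C_m is joined. *)
Definition edge_index : finType :=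
  ('I_m + ('I_m * 'I_n + 'I_m * 'I_n * bool))%type.

Local Notation base i := (inl i : edge_index).
Local Notation rim i j := (inr (inl (i, j)) : edge_index).
Local Notation spoke i j b := (inr (inr (i, j, b)) : edge_index).

Definition index_ends (x : edge_index) : {set edge_corona Cm Cn} :=
  match x with
  | inl i => [set inl i; inl (ordS i)]
  | inr (inl (i, j)) => [set inr (cycle_edge i, j); inr (cycle_edge i, ordS j)]
  | inr (inr (i, j, b)) =>
      [set inl (if b then ordS i else i); inr (cycle_edge i, j)]
  end.

Definition index_label (x : edge_index) : nat :=
  match x with
  | inl i => 3 * (m * n) + i + 1
  | inr (inl (i, j)) => n * i + j + 1
  | inr (inr (i, j, b)) =>
      m * n + 2 * (n * i + (n.-1 - j)) + (b (+) (i == m.-1 :> nat)) + 1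
  end.

Lemma index_ends_inj : injective index_ends.
Proof.
case=> [i|[[i j]|[[i j] b]]] [i'|[[i' j']|[[i' j'] b']]] /set2_inj [] [] //.
- by case=> -> _.
- by case=> e1 [e2]; rewrite (@ordS2_inj _ i i') // e2 e1 setUC.
- by case=> /ordS2_inj -> // ->.
- case=> /(ordS2_inj hm) <- e1 [e2]; rewrite (@ordS2_inj _ j j') //.
  by rewrite e2 e1 setUC.
(* The copy vertex determines [i] and [j]; the base end then determines the boolean, as [i] differs
   from [ordS i]. *)
- case=> eb [/(ordS2_inj hm) eii ->]; rewrite -eii in eb *.
  have neq := ordS_neq i (ltnW hm).
  by case: b b' eb neq => [] [] // eb /eqP[].
Qed.

Lemma corona_edgesE :
  edges (edge_corona Cm Cn) = [set index_ends x | x : edge_index].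
Proof.
apply/setP=> e; apply/imsetP/imsetP => [[[x y] /= + ->]|[x _ ->]].
  rewrite inE /=; case: x y => [u|[e1 j]] [v|[e2 j']] /=.
  - rewrite cycle_adjE 1?ltnW // => /orP[]/eqP->; first by exists (base u).
    by exists (base v); rewrite //= setUC.
  - have [i ->] := cycle_edgeP e2; case/set2P=> ->.
      by exists (spoke i j' false).
    by exists (spoke i j' true).
  - have [i ->] := cycle_edgeP e1; case/set2P=> ->.
      by exists (spoke i j false); rewrite //= setUC.
    by exists (spoke i j true); rewrite //= setUC.
  - have [i ->] := cycle_edgeP e1; rewrite cycle_adjE 1?ltnW //.
    case/andP=> /eqP <- /orP[]/eqP->; first by exists (rim i j).
    by exists (rim i j'); rewrite //= setUC.
case: x => [i|[[i j]|[[i j] b]]].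
- exists (inl i, inl (ordS i)); rewrite // inE /=.
  by rewrite cycle_adjE ?eqxx // ltnW.
- exists (inr (cycle_edge i, j), inr (cycle_edge i, ordS j)); rewrite // inE /=.
  by rewrite eqxx cycle_adjE ?eqxx // ltnW.
- exists (inl (if b then ordS i else i), inr (cycle_edge i, j)); rewrite // inE /=.
  by case: b; rewrite ?set21 ?set22.
Qed.

(** * The labels fill the interval *)

Lemma index_label_inj : injective index_label.
Proof.
have lt_radix (i : 'I_m) (j : nat) : j < n -> n * i + j < m * n.
  by have := ltn_ord i; nia.
have lt_sub (j : 'I_n) : n.-1 - j < n by have := ltn_ord j; lia.
case=> [i|[[i j]|[[i j] b]]] [i'|[[i' j']|[[i' j'] b']]] /= eq_lab.
- by congr inl; apply: val_inj => /=; lia.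
- by have := lt_radix i' _ (ltn_ord j'); lia.
- by have := lt_radix i' _ (lt_sub j'); lia.
- by have := lt_radix i _ (ltn_ord j); lia.
- have eq_rim : n * i + j = n * i' + j' by lia.
  have [ei ej] := radix_inj (ltn_ord j) (ltn_ord j') eq_rim.
  by rewrite (val_inj ei) (val_inj ej).
- by have := lt_radix i _ (ltn_ord j); lia.
- by have := lt_radix i _ (lt_sub j); lia.
- by have := lt_radix i' _ (ltn_ord j'); lia.
(* After removal of [m * n + 1], the parity of a joining label is its bit, and half of the rest has
   base [n] digits [i] and [n.-1 - j]. *)
- have eq_pair : n * i + (n.-1 - j) = n * i' + (n.-1 - j') by lia.
  have [ei ej] := radix_inj (lt_sub j) (lt_sub j') eq_pair.
  have ej' : j = j' by apply: val_inj => /=; have := ltn_ord j; have := ltn_ord j'; lia.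
  move: eq_lab; rewrite (val_inj ei) ej' => /eqP.
  by rewrite eqn_add2r eqn_add2l => /eqP/(can_inj oddb)/addIb ->.
Qed.

Lemma index_label_bound x : 1 <= index_label x <= #|edge_index|.
Proof.
rewrite !card_sum !card_prod !card_ord card_bool.
have lt_radix (i : 'I_m) (j : nat) : j < n -> n * i + j < m * n.
  by have := ltn_ord i; nia.
case: x => [i|[[i j]|[[i j] b]]] /=.
- by have := ltn_ord i; lia.
- by have := lt_radix i _ (ltn_ord j); lia.
- have lt_sub : n.-1 - j < n by lia.
  by have := lt_radix i _ lt_sub; lia.
Qed.

(** * The vertex sums *)

Lemma sum_edge_index (P : pred edge_index) (F : edge_index -> nat) :
  \sum_(x | P x) F x =
    \sum_(i | P (base i)) F (base i)
    + (\sum_i \sum_(j | P (rim i j)) F (rim i j)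
    + \sum_i \sum_j \sum_(b | P (spoke i j b)) F (spoke i j b)).
Proof.
rewrite !big_sumType /= !pair_big_dep /=; congr (_ + (_ + _)).
  by apply: eq_big => [[]|[]].
by apply: eq_big => [[[]]|[[]]].
Qed.

Local Notation label_sum u :=
  (\sum_(x | u \in index_ends x) index_label x).

(** Two rim edges and one pair of joining edges meet here. The bits of the pair are 0 and 1 in some
    order, so the exchange in the last copy leaves the sum unchanged. *)
Lemma label_sum_copy (i : 'I_m) (j : 'I_n) :
  label_sum (inr (cycle_edge i, j)) =
    n * i + j + 1 + (n * i + ord_pred j + 1)
    + (2 * (m * n) + 4 * (n * i + (n.-1 - j)) + 3).
Proof.
have edge_eq (i1 i2 : 'I_m) : (cycle_edge i1 == cycle_edge i2) = (i1 == i2).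
  by apply/eqP/eqP=> [[/ordS2_inj->]|->].
have in_rim i' j' : (inr (cycle_edge i, j) \in index_ends (rim i' j'))
    = (i == i') && (j \in [set j'; ordS j']).
  by rewrite /= !inE /eq_op /= /eq_op /= edge_eq -andb_orr.
have in_spoke i' j' b : (inr (cycle_edge i, j) \in index_ends (spoke i' j' b))
    = (i == i') && (j == j').
  by rewrite /= !inE /eq_op /= /eq_op /= edge_eq.
rewrite sum_edge_index big_pred0; last by move=> i'; rewrite /= !inE.
rewrite [X in _ + (X + _)](big_only1 i) => [||i' i'i _] //; last first.
  by apply: big_pred0 => j'; rewrite in_rim eq_sym (negPf i'i).
rewrite [X in _ + (_ + X)](big_only1 i) => [||i' i'i _] //; last first.
  rewrite big1 // => j' _; apply: big_pred0 => b.
  by rewrite in_spoke eq_sym (negPf i'i).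
rewrite [X in _ + (_ + X)](big_only1 j) => [||j' j'j _] //; last first.
  by apply: big_pred0 => b; rewrite in_spoke [j == _]eq_sym (negPf j'j) andbF.
under eq_bigl => j' do rewrite in_rim eqxx.
rewrite sum_ordS2 1?ltnW //.
under eq_bigl => b do rewrite in_spoke !eqxx.
by rewrite big_bool /=; case: (_ == _); lia.
Qed.

(** The sum of the joining labels with bit 0 in copy 0; it is kept opaque, since only a lower bound
    on it matters. *)
Definition spoke_const := \sum_(j < n) (m * n + 2 * (n.-1 - j) + 1).

Lemma sum_spoke i b :
  \sum_j index_label (spoke i j b) =
    spoke_const + 2 * (n * n * i) + n * (b (+) (i == m.-1 :> nat)).
Proof.
transitivity (spoke_const + \sum_(j < n) (2 * (n * i) + (b (+) (i == m.-1 :> nat)))).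
  by rewrite -big_split; apply: eq_bigr => j _ /=; lia.
by rewrite sum_nat_const card_ord; lia.
Qed.

Lemma label_sum_base (u : 'I_m) :
  label_sum (inl u) =
    3 * (m * n) + u + 1 + (3 * (m * n) + ord_pred u + 1)
    + (2 * spoke_const + 2 * (n * n * (u + ord_pred u))
       + n * ((u == m.-1 :> nat) + (ord_pred u != m.-1 :> nat))).
Proof.
have in_base i : (inl u \in index_ends (base i)) = (u \in [set i; ordS i]).
  by rewrite /= !inE.
have in_spoke i j b : (inl u \in index_ends (spoke i j b))
    = (u == if b then ordS i else i).
  by rewrite /= !inE orbF.
rewrite sum_edge_index.
under eq_bigl => i do rewrite in_base.
rewrite sum_ordS2 1?ltnW // [X in _ + (X + _)]big1 => [|i _]; last first.
  by apply: big_pred0 => j; rewrite /= !inE.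
(* For fixed [j], the vertex [u] meets one joining edge of copy [u] (boolean [false]) and one of
   copy [ord_pred u] (boolean [true]). *)
rewrite exchange_big /=.
under eq_bigr => j _.
  under eq_bigr => i _.
    under eq_bigl => b do rewrite in_spoke.
    rewrite big_mkcond big_bool /=; over.
  rewrite big_split -!big_mkcond /= (big_pred1 (ord_pred u)); last first.
    by move=> i; rewrite /= [RHS]eq_sym (can2_eq (@ord_predK m) (@ordSK m)).
  rewrite (big_pred1 u); last by move=> i; rewrite /= eq_sym.
  over.
rewrite big_split /= (sum_spoke (ord_pred u) true) (sum_spoke u false) /=.
by lia.
Qed.

Lemma label_sum_inj : injective (fun u => label_sum u).
Proof.
have spoke_const_ge : m * n * n <= spoke_const.
  rewrite mulnC -[X in X * _](card_ord n) -sum_nat_const.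
  by apply: leq_sum => j _; lia.
have sum_lt (u : 'I_m) (i : 'I_m) (j : 'I_n) :
    label_sum (inr (cycle_edge i, j)) < label_sum (inl u).
  rewrite label_sum_copy label_sum_base.
  have := ltn_ord i; have := ltn_ord j; have := ltn_ord (ord_pred j).
  (* Hence the sums on the base cycle exceed [12 * m * n], while those in the copies stay below
     [8 * m * n]. *)
  have : 3 * (m * n) <= spoke_const by nia.
  by nia.
have base_lt (u v : 'I_m) : u < v -> label_sum (inl u) <> label_sum (inl v).
  have ltum := ltn_ord u; have ltvm := ltn_ord v; move=> ltuv.
  rewrite !label_sum_base !val_ord_pred [v == 0 :> nat](gtn_eqF (leq_ltn_trans _ ltuv)) //.
  have n_le_nn : 3 * n <= n * n by nia.
  have -> : v.-1 != m.-1 by lia.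
  have -> : (u == m.-1 :> nat) = false by lia.
  have bv : (v == m.-1 :> nat) <= 1 by case: eqP.
  have {bv} : n * ((v == m.-1 :> nat) + true) <= 2 * n by nia.
  have : n <= n * ((v == m.-1 :> nat) + true) by nia.
  (* The bits contribute [c] at [v], where [n <= c <= 2 * n < L] with [L = 2 * N + 1]. *)
  move: (n * ((v == m.-1 :> nat) + true)) (n * n) n_le_nn => c N n_le_N cge cle.
  have [u0|u_gt0] := posnP u; rewrite ?u0 /=.
    rewrite eqxx /= muln0 => eq_sum.
    (* Up to a common constant the sums are [(m - 1) * L] at 0 and [(2 * v - 1) * L + c] at [v]; as
       [0 < c < L], they cannot agree. *)
    by have [le_mv|lt_vm] := leqP m (2 * v); nia.
  have -> : u.-1 != m.-1 by lia.
  by nia.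
(* Beyond [2 * m * n + 6 * n * i], the sum is [5 * n] at [j = 0] and [4 * n - 2 * j] otherwise.
   These values are distinct and spread over less than [6 * n], the shift from one copy to the
   next. *)
have copy_lt (i i' : 'I_m) (j j' : 'I_n) : i < i' ->
    label_sum (inr (cycle_edge i, j)) < label_sum (inr (cycle_edge i', j')).
  rewrite !label_sum_copy !val_ord_pred => lt_ii'.
  have := ltn_ord j; have := ltn_ord j'.
  have : n * i + n <= n * i' by rewrite addnC -mulnS leq_mul2l lt_ii' orbT.
  move: (n * i) (n * i') (m * n) (nat_of_ord j) (nat_of_ord j') => a b c k k'.
  by clear -hn; case: eqP; case: eqP; lia.
case=> [u|[e j]] [v|[e' j']]; rewrite /=.
- by case: (ltngtP u v) => [/base_lt|/base_lt/nesym|/val_inj->].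
- by have [i ->] := cycle_edgeP e' => eq_sum; have := sum_lt u i j'; rewrite eq_sum ltnn.
- by have [i ->] := cycle_edgeP e => eq_sum; have := sum_lt v i j; rewrite eq_sum ltnn.
have [i ->] := cycle_edgeP e; have [i' ->] := cycle_edgeP e'.
case: (ltngtP i i') => [lt_ii'|lt_ii'|/val_inj <-] eq_sum.
- by have := copy_lt i i' j j' lt_ii'; rewrite eq_sum ltnn.
- by have := copy_lt i' i j' j lt_ii'; rewrite eq_sum ltnn.
congr (inr (_, _)); apply: ord_inj; move: eq_sum.
rewrite !label_sum_copy !val_ord_pred.
have := ltn_ord j; have := ltn_ord j'.
by case: eqP; case: eqP; lia.
Qed.

End CycleCorona.

Theorem theorem3p3 (m n : nat) (hm : 3 <= m) (hn : 3 <= n) :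
  antimagic (edge_corona (cycle_graph m) (cycle_graph n)).
Proof.
apply: (@antimagic_param _ _ (@index_ends m n hm) (@index_label m n)).
- exact: index_ends_inj.
- exact: corona_edgesE.
- exact: index_label_inj.
- exact: index_label_bound.
- exact: label_sum_inj.
Qed.
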